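(* Let $k$ be a field, let $P$ be a poset and let $Q\subseteq P$ be an aligned interior system of $P$. Then the following hold. (a) For $M\in\operatorname{fprep}Q$, if $M$ admits an interval cover $\varphi\colon V\to M$, then $\operatorname{Ind}_QM$ also admits an interval cover, given by $\operatorname{Ind}_Q\varphi\colon\operatorname{Ind}_QV\to\operatorname{Ind}_QM$. (b) For $M\in\operatorname{fprep}Q$, if $M$ admits an interval resolution $\varphi_\bullet\colon V_\bullet\to M$, then $\operatorname{Ind}_QM$ also admits an interval resolution, given by $\operatorname{Ind}_Q\varphi_\bullet\colon\operatorname{Ind}_QV_\bullet\to\operatorname{Ind}_QM$. In particular, $$\operatorname{int\text{-}res\text{-}dim}M=\operatorname{int\text{-}res\text{-}dim}\operatorname{Ind}_QM.$$ (c) If every object of $\operatorname{fprep}Q$ admits an interval resolution, then every object of $\mathcal L_Q$ admits an interval resolution, and therefore $$\operatorname{int\text{-}res\text{-}gl.dim}Q=\sup_{X\in\mathcal L_Q}\operatorname{int\text{-}res\text{-}dim}X.$$ Here $\mathcal L_Q$ is the full subcategory of $\operatorname{fprep}P$ consisting of all modules isomorphic to $\operatorname{Ind}_QM$ for some $M\in\operatorname{fprep}Q$.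
   Context: A poset $P$ is regarded as a category with a unique morphism $a\to b$ iff $a\le b$. A $P$-persistence module is a functor from $P$ to $k$-vector spaces; $\operatorname{Rep}P$ is the category of these. A subset $S\subseteq P$ is an interval if it is convex ($x\le z\le y$, $x,y\in S$ imply $z\in S$) and connected (any two elements of $S$ are joined by a finite sequence in $S$ with consecutive elements comparable). The interval module $\mathbb I_S$ has value $k$ on $S$, $0$ elsewhere, and identity maps between the copies of $k$. A module is interval-decomposable if it is isomorphic to a direct sum of interval modules. With $a^\uparrow=\{x\in P:a\le x\}$, a module is finitely presentable if it is the cokernel (up to isomorphism) of a morphism $\bigoplus_{b\in\mathcal J}\mathbb I_{b^\uparrow}\to\bigoplus_{a\in\mathcal I}\mathbb I_{a^\uparrow}$ with $\mathcal I,\mathcal J$ finite multisets of elements of $P$. $\operatorname{fprep}P$ is the full subcategory of finitely presentable modules and $\mathscr I_P$ the full subcategory of finitely presentable interval-decomposable modules. A full subposet $Q\subseteq P$ is an interior system if for every $x\in P$ the maximum $\lfloor x\rfloor_Q:=\max\{y\in Q:y\le x\}$ exists. It is aligned if for every $y\in Q$ the set $\{a\in P:\lfloor a\rfloor_Q\le y\}$ is filtered (every pair of its elements has an upper bound in it). $\operatorname{Ind}_Q\colon\operatorname{Rep}Q\to\operatorname{Rep}P$ is the left Kan extension along the inclusion; for an interior system it is naturally isomorphic to pullback along $\lfloor\ \rfloor_Q$, i.e. $\operatorname{Ind}_QM(a)=M(\lfloor a\rfloor_Q)$, $\operatorname{Ind}_QM(a\le b)=M(\lfloor a\rfloor_Q\le\lfloor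 b\rfloor_Q)$. It restricts to a functor $\operatorname{fprep}Q\to\operatorname{fprep}P$. For $M\in\operatorname{fprep}P$, an interval approximation of $M$ is a morphism $\varphi\colon V\to M$ with $V\in\mathscr I_P$ such that $\operatorname{Hom}(U,V)\to\operatorname{Hom}(U,M)$ is surjective for every $U\in\mathscr I_P$. It is an interval cover if moreover every endomorphism $\kappa$ of $V$ with $\varphi=\varphi\circ\kappa$ is an automorphism. (Interval covers are surjective and unique up to isomorphism.) An interval resolution of $0\ne M\in\operatorname{fprep}P$ is an exact sequence $\cdots\to V_2\xrightarrow{\varphi_2}V_1\xrightarrow{\varphi_1}V_0\xrightarrow{\varphi_0}M\to0$ in $\operatorname{fprep}P$ with all $V_i\in\mathscr I_P$, $\varphi_0$ an interval cover of $M$, and for each $i>0$ the induced map $V_i\to\ker\varphi_{i-1}$ an interval cover of $\ker\varphi_{i-1}$. Then $\operatorname{int\text{-}res\text{-}dim}M:=\sup\{m\ge0:V_m\ne0\}$ (possibly infinite), and the value for the zero module is $0$. If every object of $\operatorname{fprep}P$ admits an interval resolution, $\operatorname{int\text{-}res\text{-}gl.dim}P:=\sup_{M\in\operatorname{fprep}P}\operatorname{int\text{-}res\text{-}dim}M$ (possibly infinite). The same definitions apply with $Q$ in place of $P$. *)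

(* Defs.v *)
From HB Require Import structures.
From mathcomp Require Import all_boot all_order all_algebra.
From mathcomp Require Import ring_quotient.
From mathcomp Require Import boolp classical_sets cardinality.

Set Implicit Arguments.
Unset Strict Implicit.
Unset Printing Implicit Defensive.

Import Order.TTheory GRing.Theory.
Local Open Scope classical_set_scope.
Local Open Scope quotient_scope.
Local Open Scope ring_scope.

Section DirectSum.
Variables (k : fieldType) (I : Type) (V : I -> lmodType k).

Definition dprod := forall i, V i.

HB.instance Definition _ := Choice.on dprod.

Let dprod_zero : dprod := fun=> 0.
Let dprod_opp (f : dprod) : dprod := fun i => - f i.
Let dprod_add (f g : dprod) : dprod := fun i => f i + g i.
Let dprod_scale (a : k) (f : dprod) : dprod := fun i => a *: f i.

Let dprod_addA : associative dprod_add.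
Proof. by move=> f g h; apply: functional_extensionality_dep => i; exact: addrA. Qed.
Let dprod_addC : commutative dprod_add.
Proof. by move=> f g; apply: functional_extensionality_dep => i; exact: addrC. Qed.
Let dprod_add0 : left_id dprod_zero dprod_add.
Proof. by move=> f; apply: functional_extensionality_dep => i; exact: add0r. Qed.
Let dprod_addN : left_inverse dprod_zero dprod_opp dprod_add.
Proof. by move=> f; apply: functional_extensionality_dep => i; exact: addNr. Qed.

HB.instance Definition _ :=
  GRing.isZmodule.Build dprod dprod_addA dprod_addC dprod_add0 dprod_addN.

Let dprod_scaleA a b f :
  dprod_scale a (dprod_scale b f) = dprod_scale (a * b) f.
Proof. by apply: functional_extensionality_dep => i; exact: scalerA. Qed.
Let dprod_scale1 : left_id 1 dprod_scale.
Proof. by move=> f; apply: functional_extensionality_dep => i; exact: scale1r. Qed.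
Let dprod_scaleDr : right_distributive dprod_scale +%R.
Proof. by move=> a f g; apply: functional_extensionality_dep => i; exact: scalerDr. Qed.
Let dprod_scaleDl f : {morph dprod_scale^~ f : a b / a + b}.
Proof. by move=> a b; apply: functional_extensionality_dep => i; exact: scalerDl. Qed.

HB.instance Definition _ := GRing.Zmodule_isLmodule.Build k dprod
  dprod_scaleA dprod_scale1 dprod_scaleDr dprod_scaleDl.

Definition dsupp (f : dprod) : set I := [set i | f i <> 0].

Definition finsupp : {pred dprod} := fun f => `[< finite_set (dsupp f) >].

Lemma finsupp_closed : submod_closed finsupp.
Proof.
split=> [|a f g /asboolP ff /asboolP fg]; apply/asboolP.
  by apply: (sub_finite_set (B := set0)) => // i; exact.
have: finite_set (dsupp f `|` dsupp g) by rewrite finite_setU.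
apply: sub_finite_set => i /= nz.
have [fi0|nfi] := pselect (f i = 0); last by left.
right=> gi0; apply: nz.
by change (a *: f i + g i = 0); rewrite fi0 gi0 scaler0 addr0.
Qed.

HB.instance Definition _ := GRing.isSubmodClosed.Build k dprod finsupp
  finsupp_closed.

Record dsum := DSum { dsum_val :> dprod; _ : dsum_val \in finsupp }.

HB.instance Definition _ := [isSub for dsum_val].
HB.instance Definition _ := [Choice of dsum by <:].
HB.instance Definition _ := [SubChoice_isSubLmodule of dsum by <:].

End DirectSum.

Section DirectSumMap.
Variables (k : fieldType) (I : Type) (V W : I -> lmodType k).
Variable F : forall i, {linear V i -> W i}.

Definition dprod_map (f : dprod V) : dprod W := fun i => F i (f i).

Lemma dprod_map_finsupp (f : dsum V) : dprod_map (val f) \in @finsupp k I W.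
Proof.
have /asboolP : val f \in @finsupp k I V by exact: valP.
move=> ff; apply/asboolP; apply: sub_finite_set ff => i /= nz f0.
by apply: nz; rewrite /dprod_map f0 linear0.
Qed.

Definition dsum_map (f : dsum V) : dsum W := DSum (dprod_map_finsupp f).

Lemma dsum_map_linear : linear dsum_map.
Proof.
move=> a f g; apply: val_inj; apply: functional_extensionality_dep => i; exact: linearP.
Qed.

HB.instance Definition _ := GRing.isLinear.Build k (dsum V) (dsum W) _
  dsum_map dsum_map_linear.

End DirectSumMap.

Section KernelCokernel.
Variables (k : fieldType) (V W : lmodType k) (f : {linear V -> W}).

Definition kernel_pred : {pred V} := fun v => f v == 0.

Lemma kernel_pred_closed : submod_closed kernel_pred.
Proof.
split=> [|a u v /eqP fu /eqP fv]; apply/eqP; first exact: linear0.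
by rewrite linearP fu fv scaler0 addr0.
Qed.

HB.instance Definition _ := GRing.isSubmodClosed.Build k V kernel_pred
  kernel_pred_closed.

Record lkernel := LKernel { lkernel_val :> V; _ : lkernel_val \in kernel_pred }.

HB.instance Definition _ := [isSub for lkernel_val].
HB.instance Definition _ := [Choice of lkernel by <:].
HB.instance Definition _ := [SubChoice_isSubLmodule of lkernel by <:].

Definition image_pred : {pred W} := fun w => `[< exists v, f v = w >].

Lemma image_pred_closed : submod_closed image_pred.
Proof.
split=> [|a u v /asboolP[u' <-] /asboolP[v' <-]]; apply/asboolP.
  by exists 0; rewrite linear0.
by exists (a *: u' + v'); rewrite linearP.
Qed.

HB.instance Definition _ := GRing.isSubmodClosed.Build k W image_pred
  image_pred_closed.

Definition lcokernel := Quotient.quot image_pred.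

HB.instance Definition _ := GRing.Zmodule.on lcokernel.
HB.instance Definition _ := Quotient.on lcokernel.

Definition coker_scale (a : k) (q : lcokernel) : lcokernel := \pi_lcokernel (a *: repr q).

Lemma lcokernel_eqP (u v : W) :
  \pi_lcokernel u = \pi_lcokernel v <-> u - v \in image_pred.
Proof. by rewrite (Quotient.idealrBE image_pred); split=> /eqP. Qed.

Let pi_scale a w : \pi_lcokernel (a *: w) = coker_scale a (\pi w).
Proof.
apply/lcokernel_eqP; rewrite -scalerBr rpredZ //.
by apply/lcokernel_eqP; rewrite reprK.
Qed.

Let coker_scaleA a b q :
  coker_scale a (coker_scale b q) = coker_scale (a * b) q.
Proof. by elim/quotW: q => w; rewrite -(pi_scale b w) -!pi_scale scalerA. Qed.
Let coker_scale1 : left_id 1 coker_scale.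
Proof. by elim/quotW=> w; rewrite -pi_scale scale1r. Qed.
Let coker_scaleDr : right_distributive coker_scale +%R.
Proof.
move=> a; elim/quotW=> u; elim/quotW=> v.
by rewrite -raddfD -!pi_scale -raddfD scalerDr.
Qed.
Let coker_scaleDl q : {morph coker_scale^~ q : a b / a + b}.
Proof.
by elim/quotW: q => w a b; rewrite -!pi_scale -raddfD scalerDl.
Qed.

HB.instance Definition _ := GRing.Zmodule_isLmodule.Build k lcokernel
  coker_scaleA coker_scale1 coker_scaleDr coker_scaleDl.

Definition coker_proj (w : W) : lcokernel := \pi_lcokernel w.

Lemma coker_proj_linear : linear coker_proj.
Proof.
move=> a u v; rewrite /coker_proj.
transitivity (\pi_lcokernel (a *: u) + \pi_lcokernel v); first exact: raddfD.
by rewrite pi_scale.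
Qed.

HB.instance Definition _ := GRing.isLinear.Build k W lcokernel _
  coker_proj coker_proj_linear.

Lemma coker_proj_eq0 w : coker_proj w = 0 <-> exists v, f v = w.
Proof.
rewrite -(linear0 coker_proj).
by split=> [/lcokernel_eqP|h]; [|apply/lcokernel_eqP]; rewrite subr0;
  [move/asboolP|apply/asboolP].
Qed.

Lemma coker_projW (A : lcokernel -> Prop) :
  (forall w, A (coker_proj w)) -> forall q, A q.
Proof. by move=> Aw; elim/quotW. Qed.

End KernelCokernel.

Section KernelCokernelMaps.
Variable k : fieldType.

Section Kernel.
Variables (V W V' W' : lmodType k).
Variables (f : {linear V -> W}) (f' : {linear V' -> W'}).
Variables (g : {linear V -> V'}) (h : {linear W -> W'}).
Hypothesis square : forall v, h (f v) = f' (g v).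

Lemma kernel_map_subproof (v : lkernel f) : g (val v) \in kernel_pred f'.
Proof. by apply/eqP; rewrite -square (eqP (valP v)) linear0. Qed.

Definition kernel_map (v : lkernel f) : lkernel f' :=
  LKernel (kernel_map_subproof v).

Lemma kernel_map_linear : linear kernel_map.
Proof. by move=> a u v; apply: val_inj; exact: linearP. Qed.

HB.instance Definition _ := GRing.isLinear.Build k (lkernel f) (lkernel f') _
  kernel_map kernel_map_linear.

Definition coker_map (q : lcokernel f) : lcokernel f' :=
  coker_proj f' (h (repr q)).

Lemma coker_map_proj w : coker_map (coker_proj f w) = coker_proj f' (h w).
Proof.
apply/eqP; rewrite -subr_eq0 -linearB -linearB; apply/eqP/coker_proj_eq0.
have : coker_proj f (repr (coker_proj f w) - w) = 0.
  by rewrite linearB /= {1}/coker_proj reprK subrr.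
by move=> /coker_proj_eq0[v <-]; exists (g v).
Qed.

Lemma coker_map_linear : linear coker_map.
Proof.
move=> a; elim/coker_projW=> u; elim/coker_projW=> v.
by rewrite -linearP !coker_map_proj !linearP.
Qed.

Definition coker_linear : {linear lcokernel f -> lcokernel f'} :=
  HB.pack coker_map
    (GRing.isLinear.Build k (lcokernel f) (lcokernel f') _ coker_map
       coker_map_linear).

Lemma coker_linearE w : coker_linear (coker_proj f w) = coker_proj f' (h w).
Proof. exact: coker_map_proj. Qed.

End Kernel.

Section Lift.
Variables (U V W : lmodType k) (f : {linear V -> W}) (g : {linear U -> V}).
Hypothesis fg0 : forall u, f (g u) = 0.

Lemma kernel_lift_subproof u : g u \in kernel_pred f.
Proof. exact/eqP. Qed.

Definition kernel_lift (u : U) : lkernel f :=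
  LKernel (kernel_lift_subproof u).

Lemma kernel_lift_linear : linear kernel_lift.
Proof. by move=> a u v; apply: val_inj; exact: linearP. Qed.

HB.instance Definition _ := GRing.isLinear.Build k U (lkernel f) _
  kernel_lift kernel_lift_linear.

End Lift.

End KernelCokernelMaps.

Section Modules.
Variables (k : fieldType) (d : Order.disp_t) (P : porderType d).

Record pmod := PMod {
  pobj :> P -> lmodType k;
  ptrans : forall x y, (x <= y)%O -> {linear pobj x -> pobj y};
  ptrans_id : forall x (h : (x <= x)%O) v, ptrans h v = v;
  ptrans_comp : forall x y z (hxy : (x <= y)%O) (hyz : (y <= z)%O)
    (hxz : (x <= z)%O) v, ptrans hxz v = ptrans hyz (ptrans hxy v) }.

Record pmor (M N : pmod) := PMor {
  papp :> forall x, {linear M x -> N x};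
  pnat : forall x y (h : (x <= y)%O) v,
    papp y (ptrans M h v) = ptrans N h (papp x v) }.

Definition peq (M N : pmod) (f g : pmor M N) := forall x, f x =1 g x.

Definition pid (M : pmod) : pmor M M :=
  @PMor M M (fun=> [the {linear _ -> _} of idfun]) (fun _ _ _ _ => erefl).

Lemma pcomp_nat (L M N : pmod) (g : pmor M N) (f : pmor L M) x y
    (h : (x <= y)%O) v :
  (g y \o f y) (ptrans L h v) = ptrans N h ((g x \o f x) v).
Proof. by rewrite /= !pnat. Qed.

Definition pcomp (L M N : pmod) (g : pmor M N) (f : pmor L M) : pmor L N :=
  @PMor L N (fun x => [the {linear _ -> _} of g x \o f x]) (pcomp_nat g f).

Definition pinverse (M N : pmod) (f : pmor M N) (g : pmor N M) :=
  peq (pcomp g f) (pid M) /\ peq (pcomp f g) (pid N).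

Definition piso (M N : pmod) := exists f : pmor M N, exists g, pinverse f g.

Definition pauto (M : pmod) (f : pmor M M) := exists g, pinverse f g.

Definition pzero (M : pmod) := forall x (v : M x), v = 0.

Definition psurj (M N : pmod) (f : pmor M N) := forall x w, exists v, f x v = w.

Definition pexact (L M N : pmod) (g : pmor L M) (f : pmor M N) :=
  forall x (v : M x), f x v = 0 <-> exists u, g x u = v.

Section DirectSum.
Variables (I : Type) (F : I -> pmod).

Let obj x : lmodType k := dsum (fun i => F i x).

Let trans x y (h : (x <= y)%O) : {linear obj x -> obj y} :=
  dsum_map (fun i => ptrans (F i) h).

Lemma psum_id x (h : (x <= x)%O) v : trans h v = v.
Proof.
by apply: val_inj; apply: functional_extensionality_dep => i; exact: ptrans_id.
Qed.

Lemma psum_comp x y z (hxy : (x <= y)%O) (hyz : (y <= z)%O) (hxz : (x <= z)%O)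
  v : trans hxz v = trans hyz (trans hxy v).
Proof.
apply: val_inj; apply: functional_extensionality_dep => i; exact: ptrans_comp.
Qed.

Definition psum : pmod := PMod psum_id psum_comp.

End DirectSum.

Section Kernel.
Variables (M N : pmod) (f : pmor M N).

Let trans x y (h : (x <= y)%O) : {linear lkernel (f x) -> lkernel (f y)} :=
  kernel_map (fun v => esym (pnat f h v)).

Lemma pker_id x (h : (x <= x)%O) v : trans h v = v.
Proof. by apply: val_inj; exact: ptrans_id. Qed.

Lemma pker_comp x y z (hxy : (x <= y)%O) (hyz : (y <= z)%O) (hxz : (x <= z)%O)
  v : trans hxz v = trans hyz (trans hxy v).
Proof. by apply: val_inj; exact: ptrans_comp. Qed.

Definition pker : pmod := PMod pker_id pker_comp.

Variables (L : pmod) (g : pmor L M).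
Hypothesis fg0 : forall x u, f x (g x u) = 0.

Lemma pker_lift_nat x y (h : (x <= y)%O) v :
  kernel_lift (@fg0 y) (ptrans L h v) = ptrans pker h (kernel_lift (@fg0 x) v).
Proof. by apply: val_inj; exact: pnat. Qed.

Definition pker_lift : pmor L pker :=
  @PMor L pker (fun x => kernel_lift (@fg0 x)) pker_lift_nat.

End Kernel.

Section Cokernel.
Variables (M N : pmod) (f : pmor M N).

Let trans x y (h : (x <= y)%O) : {linear lcokernel (f x) -> lcokernel (f y)} :=
  coker_linear (fun v => esym (pnat f h v)).

Lemma pcoker_id x (h : (x <= x)%O) q : trans h q = q.
Proof.
by elim/coker_projW: q => w; rewrite /trans coker_linearE ptrans_id.
Qed.

Lemma pcoker_comp x y z (hxy : (x <= y)%O) (hyz : (y <= z)%O) (hxz : (x <= z)%O)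
  q : trans hxz q = trans hyz (trans hxy q).
Proof.
elim/coker_projW: q => w; rewrite /trans !coker_linearE.
by rewrite -(ptrans_comp hxy hyz hxz).
Qed.

Definition pcoker : pmod := PMod pcoker_id pcoker_comp.

End Cokernel.

Definition convex_set (S : set P) :=
  forall x y z, S x -> S y -> (x <= z)%O -> (z <= y)%O -> S z.

Definition connected_set (S : set P) := forall x y, S x -> S y ->
  exists s : seq P,
    [/\ forall z, z \in s -> S z, path >=<%O x s & last x s = y].

Record interval := Interval {
  iset :> set P;
  iconvex : convex_set iset;
  iconnected : connected_set iset }.

Section IntervalModule.
Variable S : interval.

(* k^1 on S and k^0 elsewhere; an all-ones matrix is the identity of k^1 when
   both ends lie in S and is the (unique) zero map otherwise. *)
Let obj x : lmodType k := 'rV[k]_(x \in (S : set P)).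

Let trans x y (_ : (x <= y)%O) : {linear obj x -> obj y} :=
  mulmxr (const_mx 1).

Lemma imod_id x (h : (x <= x)%O) v : trans h v = v.
Proof.
rewrite /trans /obj /= in v *; case: (x \in _) in v * => /=.
  by apply/rowP=> i; rewrite mxE big_ord1 !mxE mulr1 !ord1.
by apply/rowP=> -[].
Qed.

Lemma imod_comp x y z (hxy : (x <= y)%O) (hyz : (y <= z)%O) (hxz : (x <= z)%O)
  v : trans hxz v = trans hyz (trans hxy v).
Proof.
rewrite /trans /obj /= in v *.
have: x \in (S : set P) -> z \in (S : set P) -> y \in (S : set P).
  by rewrite !in_setE => Sx Sz; exact: iconvex Sx Sz hxy hyz.
case: (x \in _) in v *; last by rewrite (thinmx0 v) !mul0mx.
case: (z \in _) => [|_]; last by apply/rowP=> -[].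
move=> /(_ isT isT) -> /=.
by apply/rowP=> i; rewrite !mxE !big_ord1 !mxE !big_ord1 !mxE !mulr1.
Qed.

Definition imod : pmod := PMod imod_id imod_comp.

End IntervalModule.

Definition upset (a : P) : set P := [set x | (a <= x)%O].

Lemma upset_convex a : convex_set (upset a).
Proof. by move=> x y z ax _ xz _; exact: le_trans xz. Qed.

Lemma upset_connected a : connected_set (upset a).
Proof.
move=> x y ax ay; exists [:: a; y]; split=> //=.
  by move=> z; rewrite !inE => /orP[] /eqP -> //; exact: lexx.
by rewrite andbT; apply/andP; split; rewrite /Order.comparable ?ax ?ay ?orbT.
Qed.

Definition upint (a : P) : interval :=
  Interval (@upset_convex a) (@upset_connected a).

Definition int_decomposable (M : pmod) :=
  exists (I : Type) (S : I -> interval), piso M (psum (fun i => imod (S i))).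

Definition free_mod (s : seq P) : pmod :=
  psum (fun i : 'I_(size s) => imod (upint (tnth (in_tuple s) i))).

Definition fprep (M : pmod) := exists (J I : seq P)
  (f : pmor (free_mod J) (free_mod I)), piso M (pcoker f).

Definition fp_int_decomposable (M : pmod) := fprep M /\ int_decomposable M.

Definition int_approx (V M : pmod) (phi : pmor V M) :=
  [/\ fprep M, fp_int_decomposable V &
      forall U, fp_int_decomposable U -> forall psi : pmor U M,
        exists chi : pmor U V, peq (pcomp phi chi) psi].

Definition int_cover (V M : pmod) (phi : pmor V M) :=
  int_approx phi /\
  forall kappa : pmor V V, peq phi (pcomp phi kappa) -> pauto kappa.

(* A sequence ... -> V_2 -> V_1 -> V_0 -> M; [aug_map i] is the i-th arrow, with
   source [aug_obj i] and target [aug_target M aug_obj i]. *)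
Definition aug_target (M : pmod) (V : nat -> pmod) (i : nat) : pmod :=
  if i is j.+1 then V j else M.

Record aug_seq (M : pmod) := AugSeq {
  aug_obj :> nat -> pmod;
  aug_map : forall i, pmor (aug_obj i) (aug_target M aug_obj i) }.

Definition int_resolution (M : pmod) (V : aug_seq M) :=
  [/\ fprep M /\ (forall i, fp_int_decomposable (V i)),
      psurj (aug_map V 0),
      forall i, pexact (L := V i.+1) (M := V i) (aug_map V i.+1) (aug_map V i),
      int_cover (aug_map V 0) &
      forall i (h : forall x u, aug_map V i x (aug_map V i.+1 x u) = 0),
        int_cover (pker_lift (L := V i.+1) (M := V i) h)].

Definition admits_int_resolution (M : pmod) :=
  exists V : aug_seq M, int_resolution V.

End Modules.

(* [None] is infinity. *)
Definition enat := option nat.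

Definition enat_le (a b : enat) : bool :=
  match a, b with
  | _, None => true
  | None, Some _ => false
  | Some m, Some n => (m <= n)%N
  end.

Definition enat_bound (A : set enat) (n : nat) : bool :=
  `[< forall a, A a -> enat_le a (Some n) >].

(* The least upper bound in enat; in particular the supremum of set0 is 0. *)
Definition enat_sup (A : set enat) : enat :=
  if pselect (exists n, enat_bound A n) is left h then Some (ex_minn h)
  else None.

Lemma enat_sup_ub (A : set enat) a : A a -> enat_le a (enat_sup A).
Proof.
move=> Aa; rewrite /enat_sup; case: pselect => [h|_]; last by case: a {Aa}.
by case: ex_minnP => n /asboolP + _; apply.
Qed.

Lemma enat_sup_least (A : set enat) b :
  (forall a, A a -> enat_le a b) -> enat_le (enat_sup A) b.
Proof.
case: b => [b|] ub; last by case: enat_sup.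
rewrite /enat_sup; case: pselect => [h|]; last first.
  by case; exists b; apply/asboolP.
by case: ex_minnP => n _ /=; apply; apply/asboolP.
Qed.

Section Dimensions.
Variables (k : fieldType) (d : Order.disp_t) (P : porderType d).

Definition resolution_length (M : pmod k P) (V : aug_seq M) : enat :=
  enat_sup [set Some m | m in [set m | ~ pzero (V m)]].

(* Interval resolutions are unique up to isomorphism, so any of them may be
   used; those of the zero module are zero and give the value 0.  The value is
   meaningless when M has no interval resolution. *)
Definition int_res_dim (M : pmod k P) : enat :=
  if pselect (admits_int_resolution M) is left h
  then resolution_length (projT1 (cid h)) else Some 0%N.

End Dimensions.

(* The supremum over [set int_res_dim X | X in C]; image is not available for a class of
   modules because of universe constraints. *)
Definition sup_int_res_dim (k : fieldType) d (P : porderType d)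
    (C : pmod k P -> Prop) : enat :=
  enat_sup [set n | exists2 X, C X & int_res_dim X = n].

Definition int_res_gldim (k : fieldType) d (P : porderType d) : enat :=
  sup_int_res_dim (@fprep k d P).

Section Subposet.
Variables (d : Order.disp_t) (P : porderType d) (Q : set P).

Definition subposet := {x : P | x \in Q}.

HB.instance Definition _ := SubChoice.on subposet.
HB.instance Definition _ := [SubChoice_isSubPOrder of subposet by <: with d].

Definition is_floor (x y : P) :=
  [/\ Q y, (y <= x)%O & forall z, Q z -> (z <= x)%O -> (z <= y)%O].

Definition interior_system := forall x, exists y, is_floor x y.

Hypothesis hQ : interior_system.

Definition floor_val (x : P) : P := projT1 (cid (hQ x)).

Lemma floor_valP x : is_floor x (floor_val x).
Proof. exact: projT2 (cid (hQ x)). Qed.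

Lemma floor_subproof x : floor_val x \in Q.
Proof. by rewrite in_setE; case: (floor_valP x). Qed.

Definition floor (x : P) : subposet := Sub (floor_val x) (floor_subproof x).

Lemma floor_le x : (val (floor x) <= x)%O.
Proof. by case: (floor_valP x). Qed.

Lemma floor_max x (y : subposet) : (val y <= x)%O -> (y <= floor x)%O.
Proof.
case: (floor_valP x) => _ _ max yx; apply: max => //.
by have := valP y; rewrite in_setE.
Qed.

Lemma floor_mono x y : (x <= y)%O -> (floor x <= floor y)%O.
Proof. by move=> xy; apply: floor_max; exact: le_trans (floor_le x) xy. Qed.

Definition filtered_set (A : set P) :=
  forall a b, A a -> A b -> exists c, [/\ A c, (a <= c)%O & (b <= c)%O].

Definition aligned :=
  forall y : subposet, filtered_set [set a | (floor a <= y)%O].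

End Subposet.

Section Induction.
Variables (k : fieldType) (d : Order.disp_t) (P : porderType d) (Q : set P).
Hypothesis hQ : interior_system Q.

Let floor := floor hQ.

(* The left Kan extension along the inclusion of Q, computed as the pullback
   along floor; its universal property is Ind_left_Kan below. *)
Section Object.
Variable M : pmod k (subposet Q).

Let trans x y (h : (x <= y)%O) : {linear M (floor x) -> M (floor y)} :=
  ptrans M (floor_mono hQ h).

Lemma ind_id x (h : (x <= x)%O) v : trans h v = v.
Proof. exact: ptrans_id. Qed.

Lemma ind_comp x y z (hxy : (x <= y)%O) (hyz : (y <= z)%O) (hxz : (x <= z)%O)
  v : trans hxz v = trans hyz (trans hxy v).
Proof. exact: ptrans_comp. Qed.

Definition Ind : pmod k P :=
  @PMod k d P (fun x => M (floor x)) trans ind_id ind_comp.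

End Object.

Definition Ind_mor (M N : pmod k (subposet Q)) (f : pmor M N) :
    pmor (Ind M) (Ind N) :=
  @PMor k d P (Ind M) (Ind N) (fun x => f (floor x))
    (fun x y h => pnat f (floor_mono hQ h)).

Definition Ind_seq (M : pmod k (subposet Q)) (V : aug_seq M) :
    aug_seq (Ind M) :=
  @AugSeq k d P (Ind M) (fun i => Ind (V i)) (fun i =>
    match i return pmor (Ind (V i)) (aug_target (Ind M) (fun j => Ind (V j)) i)
    with
    | 0 => Ind_mor (aug_map V 0)
    | j.+1 => Ind_mor (aug_map V j.+1)
    end).

Definition Ind_image (X : pmod k P) :=
  fprep X /\ exists M : pmod k (subposet Q), fprep M /\ piso X (Ind M).

Definition Res (N : pmod k P) : pmod k (subposet Q) :=
  @PMod k d (subposet Q) (fun q => N (val q))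
    (fun x y (h : (x <= y)%O) => ptrans N (h : (val x <= val y)%O))
    (fun x h => @ptrans_id k d P N (val x) h)
    (fun x y z hxy hyz hxz => @ptrans_comp k d P N _ _ _ hxy hyz hxz).

Definition Res_mor (M N : pmod k P) (f : pmor M N) : pmor (Res M) (Res N) :=
  @PMor k d (subposet Q) (Res M) (Res N) (fun q => f (val q))
    (fun x y (h : (x <= y)%O) => pnat f (h : (val x <= val y)%O)).

Lemma le_floor_val (q : subposet Q) : (q <= floor (val q))%O.
Proof. by apply: floor_max. Qed.

Lemma ind_unit_nat M x y (h : (x <= y)%O) v :
  ptrans M (le_floor_val y) (ptrans M h v)
  = ptrans (Res (Ind M)) h (ptrans M (le_floor_val x) v).
Proof.
have hxy : (x <= floor (val y))%O by exact: le_trans h (le_floor_val y).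
by rewrite -(ptrans_comp h _ hxy); exact: ptrans_comp.
Qed.

Definition ind_unit M : pmor M (Res (Ind M)) :=
  @PMor k d (subposet Q) M (Res (Ind M)) (fun q => ptrans M (le_floor_val q))
    (@ind_unit_nat M).

Lemma Ind_left_Kan M (N : pmod k P) (f : pmor M (Res N)) :
  exists2 g : pmor (Ind M) N, peq (pcomp (Res_mor g) (ind_unit M)) f
    & forall g' : pmor (Ind M) N,
        peq (pcomp (Res_mor g') (ind_unit M)) f -> peq g' g.
Proof.
pose app x : {linear Ind M x -> N x} :=
  [the {linear _ -> _} of ptrans N (floor_le hQ x) \o f (floor x)].
have appN x y (h : (x <= y)%O) v :
    app y (ptrans (Ind M) h v) = ptrans N h (app x v).
  have hxy : (val (floor x) <= y)%O by exact: le_trans (floor_le hQ x) h.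
  rewrite /= pnat /= -(ptrans_comp _ _ hxy).
  exact: ptrans_comp.
exists (PMor appN) => [q v|g' g'f x v] /=.
  have h : (val q <= val q)%O by exact: lexx.
  by rewrite pnat /= -(ptrans_comp _ _ h) ptrans_id.
rewrite -(g'f (floor x)); apply: etrans (pnat g' (floor_le hQ x) _).
congr (g' x _).
have h : (floor x <= floor x)%O by exact: lexx.
by rewrite -(ptrans_comp _ _ h) ptrans_id.
Qed.

End Induction.

(* Main.v *)
Require Import Defs.
From HB Require Import structures.
From mathcomp Require Import all_boot all_order all_algebra.
From mathcomp Require Import boolp classical_sets cardinality fsbigop.

(** Ind is the pullback along [floor : P -> Q].  It is exact, fully faithful
    ([Ind_full], [Ind_faithful]) and commutes with direct sums.  It sends the
    interval module of S to that of the preimage of S, and that of the up-set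
    of q in Q to that of the up-set of q in P, so it preserves finitely
    presentable and interval-decomposable modules.  For a cover phi of M, the
    minimality of Ind phi then follows from that of phi by full faithfulness.

    Alignment is needed to lift a morphism [U -> Ind M], with U finitely
    presentable and interval-decomposable, through Ind phi.  Ind has a left
    adjoint, whose value on U at y in Q is the colimit of U over
    [{a | floor a <= y}].  By alignment this index set is directed, so on the
    interval module of S the colimit is k or 0 according to whether S contains
    some a in the index set together with everything above a in it.  The set
    [contraction S] of the y where it is k is convex, not necessarily
    connected, and the adjoint sends the interval module of S to the direct sum
    of the interval modules of the connected components of [contraction S]
    ([univ_thin], [components_thin]).  A left adjoint also preserves cokernels,
    and it sends free modules to free modules, hence it sends U to a finitely
    presentable interval-decomposable module L.  A morphism [U -> Ind M]
    corresponds to a morphism [L -> M], which lifts through phi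
    ([Ind_int_cover]).  Only the universal arrows [U -> Ind L] of the modules
    that matter are constructed ([univ]), never the whole adjoint functor.

    Since Ind is exact and commutes with kernels, it carries interval
    resolutions to interval resolutions ([Ind_int_resolution]).  Covers, hence
    resolutions, are unique up to isomorphism ([int_resolution_unique]), so the
    dimension of M may be read off any resolution; Ind preserves and reflects
    the vanishing of modules, and the equalities of dimensions follow. *)

Set Implicit Arguments.
Unset Strict Implicit.
Unset Printing Implicit Defensive.

Import Order.TTheory GRing.Theory.
Local Open Scope classical_set_scope.
Local Open Scope ring_scope.

(* These names also denote unrelated notions of the imported libraries. *)
Local Notation pcomp := Defs.pcomp.
Local Notation pnat := Defs.pnat.
Local Notation interval := Defs.interval.
Local Notation Interval := Defs.Interval.

(** * Isomorphisms, surjections and finite presentations *)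

Section Morphisms.
Variables (k : fieldType) (d : Order.disp_t) (P : porderType d).
Implicit Types L M N : pmod k P.

(** Being an isomorphism, as a property of a morphism. *)
Definition pbij M N (f : pmor M N) := exists g, pinverse f g.

Lemma pbij_id M : pbij (pid M).
Proof. by exists (pid M); split. Qed.

Lemma pbij_comp L M N (g : pmor M N) (f : pmor L M) :
  pbij g -> pbij f -> pbij (pcomp g f).
Proof.
move=> [g' [g'g gg']] [f' [f'f ff']]; exists (pcomp f' g'); split=> x v /=.
  by have /= -> := g'g x (f x v); apply: f'f.
by have /= -> := ff' x (g' x v); apply: gg'.
Qed.

Lemma piso_refl M : piso M M.
Proof. by exists (pid M); apply: pbij_id. Qed.

Lemma piso_sym M N : piso M N -> piso N M.
Proof. by move=> [f [g [gf fg]]]; exists g, f. Qed.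

Lemma piso_trans L M N : piso L M -> piso M N -> piso L N.
Proof. by move=> [f fb] [g gb]; exists (pcomp g f); apply: pbij_comp. Qed.

Lemma pbij_inj M N (f : pmor M N) : pbij f -> forall x v, f x v = 0 -> v = 0.
Proof. by move=> [g [gf _]] x v fv0; rewrite -[v]gf /= fv0 linear0. Qed.

Lemma pbij_surj M N (f : pmor M N) : pbij f -> psurj f.
Proof. by move=> [g [_ fg]] x w; exists (g x w); apply: fg. Qed.

Lemma psurj_comp L M N (g : pmor M N) (f : pmor L M) :
  psurj g -> psurj f -> psurj (pcomp g f).
Proof. by move=> sg sf x w; have [v <-] := sg x w; have [u <-] := sf x v; exists u. Qed.

Lemma psurj_epi L M N (p : pmor L M) (f g : pmor M N) :
  psurj p -> peq (pcomp f p) (pcomp g p) -> peq f g.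
Proof. by move=> sp fg x w; have [v <-] := sp x w; apply: fg. Qed.

(** A pointwise surjection has the universal property of a cokernel of its
    kernel. *)
Lemma psurj_factor L M N (p : pmor L M) (q : pmor L N) : psurj p ->
  (forall x v, p x v = 0 -> q x v = 0) -> exists r : pmor M N, peq (pcomp r p) q.
Proof.
move=> sp pq.
have wd x u v : p x u = p x v -> q x u = q x v.
  move=> puv; apply/eqP; rewrite -subr_eq0 -linearB; apply/eqP/pq.
  by rewrite linearB puv subrr.
pose pre x (w : M x) : L x := projT1 (cid (sp x w)).
have preK x w : p x (pre x w) = w := projT2 (cid (sp x w)).
have lin x : linear (fun w => q x (pre x w)).
  by move=> a u v /=; rewrite -linearP; apply: wd; rewrite linearP !preK.
pose r x : {linear M x -> N x} := HB.pack (fun w => q x (pre x w))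
  (GRing.isLinear.Build k (M x) (N x) _ (fun w => q x (pre x w)) (lin x)).
have nat x y (h : (x <= y)%O) w : r y (ptrans M h w) = ptrans N h (r x w).
  by rewrite /r /= -pnat; apply: wd; rewrite pnat !preK.
by exists (PMor nat) => x v; rewrite /r /=; apply: wd; rewrite preK.
Qed.

Lemma pbijP M N (f : pmor M N) :
  psurj f -> (forall x v, f x v = 0 -> v = 0) -> pbij f.
Proof.
move=> sf jf; have [g gf] := psurj_factor (q := pid M) sf jf.
exists g; split=> //; apply: (psurj_epi sf) => x v /=.
by have /= -> := gf x v.
Qed.

(** Two quotients of L with the same kernel are isomorphic. *)
Lemma piso_quot L M N (p : pmor L M) (q : pmor L N) : psurj p -> psurj q ->
  (forall x v, p x v = 0 <-> q x v = 0) -> piso M N.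
Proof.
move=> sp sq pq; have [r rp] := psurj_factor sp (fun x v => (pq x v).1).
exists r; apply: pbijP => x w.
  by have [v <-] := sq x w; exists (p x v); apply: rp.
by have [v <-] := sp x w; rewrite (rp x v : r x (p x v) = _) => /pq.
Qed.

Lemma pcoker_proj_nat M N (f : pmor M N) x y (h : (x <= y)%O) w :
  coker_proj (f y) (ptrans N h w) = ptrans (pcoker f) h (coker_proj (f x) w).
Proof. exact/esym/coker_linearE. Qed.

(** The quotient map onto the cokernel, as a morphism of persistence modules. *)
Definition pcoker_proj M N (f : pmor M N) : pmor N (pcoker f) :=
  @PMor k d P N (pcoker f) (fun x => [the {linear _ -> _} of coker_proj (f x)])
    (@pcoker_proj_nat M N f).

Lemma pcoker_proj_surj M N (f : pmor M N) : psurj (pcoker_proj f).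
Proof. by move=> x; elim/coker_projW=> w; exists w. Qed.

Lemma pcoker_proj_exact M N (f : pmor M N) : pexact f (pcoker_proj f).
Proof. by move=> x v; apply: coker_proj_eq0. Qed.

(** A finite presentation, up to isomorphism of the two free modules, as a right
    exact sequence. *)
Lemma fprepP M : fprep M <-> exists (J I : seq P) (A B : pmod k P)
  (f : pmor A B) (p : pmor B M),
  [/\ piso A (free_mod k J), piso B (free_mod k I), psurj p & pexact f p].
Proof.
split=> [[J [I [f /piso_sym [e be]]]]|].
  exists J, I, _, _, f, (pcomp e (pcoker_proj f)); split.
  - exact: piso_refl.
  - exact: piso_refl.
  - apply: psurj_comp; [exact: pbij_surj|exact: pcoker_proj_surj].
  - move=> x v; rewrite -(pcoker_proj_exact f v) /=; split=> [|->].
      exact: (pbij_inj (f := e) be).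
    exact: linear0.
move=> [J [I [A [B [f [p [[a [a' [a'a aa']]] [b [b' [b'b bb']]] sp ex]]]]]]].
exists J, I, (pcomp b (pcomp f a')).
apply: (piso_quot (p := pcomp p b') (q := pcoker_proj _)).
- apply: psurj_comp => // x w; exists (b x w); exact: b'b.
- exact: pcoker_proj_surj.
move=> x v; rewrite (pcoker_proj_exact _ v) /=; split.
  by move=> /ex [u fu]; exists (a x u); rewrite [a' x _]a'a fu [LHS]bb'.
by move=> [u <-]; rewrite [b' x _]b'b; apply/ex; exists (a' x u).
Qed.

Lemma fprep_piso M N : piso M N -> fprep M -> fprep N.
Proof.
move=> /piso_sym MN [J [I [f Mf]]]; exists J, I, f; exact: piso_trans Mf.
Qed.

Lemma pnull_nat M N x y (h : (x <= y)%O) v :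
  (\0 : {linear M y -> N y}) (ptrans M h v)
  = ptrans N h ((\0 : {linear M x -> N x}) v).
Proof. by rewrite /= linear0. Qed.

(** The zero morphism. *)
Definition pnull M N : pmor M N := PMor (@pnull_nat M N).

End Morphisms.

(** * Direct sums as coproducts *)

Section Sums.
Variables (k : fieldType) (d : Order.disp_t) (P : porderType d).

Lemma psum_map_nat (I : Type) (F G : I -> pmod k P)
  (f : forall i, pmor (F i) (G i)) x y (h : (x <= y)%O) v :
  dsum_map (fun i => f i y) (ptrans (psum F) h v)
  = ptrans (psum G) h (dsum_map (fun i => f i x) v).
Proof.
by apply: val_inj; apply: functional_extensionality_dep => i; exact: pnat.
Qed.

Definition psum_map (I : Type) (F G : I -> pmod k P)
    (f : forall i, pmor (F i) (G i)) : pmor (psum F) (psum G) :=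
  @PMor k d P (psum F) (psum G)
    (fun x => [the {linear _ -> _} of dsum_map (fun i => f i x)])
    (psum_map_nat f).

Lemma piso_psum (I : Type) (F G : I -> pmod k P) :
  (forall i, piso (F i) (G i)) -> piso (psum F) (psum G).
Proof.
move=> FG; pose f i := projT1 (cid (FG i)).
pose g i := projT1 (cid (projT2 (cid (FG i)))).
have fg i : pinverse (f i) (g i) := projT2 (cid (projT2 (cid (FG i)))).
exists (psum_map f), (psum_map g).
by split=> x v; apply: val_inj; apply: functional_extensionality_dep => i;
  [apply: (fg i).1 | apply: (fg i).2].
Qed.

Section Universal.
Variables (I : Type) (F : I -> pmod k P).

(** Two elements of a direct sum have a common finite support.  The index type
    is arbitrary, so [{classic I}] is used to have decidable equality on it. *)
Lemma dsum_supp x (u v : psum F x) : exists2 r : seq {classic I}, uniq r &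
  forall i, i \notin r -> dsum_val u i = 0 /\ dsum_val v i = 0.
Proof.
have fs (w : psum F x) : finite_set (dsupp w : set {classic I}).
  by case: w => w /= /asboolP.
have /finite_seqP[r ruv] : finite_set (dsupp u `|` dsupp v : set {classic I}).
  by rewrite finite_setU; split; apply: fs.
exists (undup r); first exact: undup_uniq.
move=> i; rewrite mem_undup => ir.
have nuv : ~ ((dsupp u `|` dsupp v : set {classic I}) i).
  by rewrite ruv /=; apply/negP.
by split; apply: contrapT => nz; apply: nuv; [left|right].
Qed.

Section Out.
Variables (N : pmod k P) (f : forall i, pmor (F i) N).

(** The copairing of a family of morphisms; the sum has finite support. *)
Definition psum_out_fun x (u : psum F x) : N x :=
  \sum_(i \in [set: {classic I}]) f i x (dsum_val u i).

Lemma psum_outE x (u : psum F x) (r : seq {classic I}) : uniq r ->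
  (forall i, i \notin r -> dsum_val u i = 0) ->
  psum_out_fun u = \sum_(i <- r) f i x (dsum_val u i).
Proof.
move=> ur ru; rewrite /psum_out_fun (fsbigE r) //.
- by apply: eq_bigl => i; rewrite in_setT.
- by move=> i _ /ru ->; rewrite linear0.
Qed.

Lemma psum_out_linear x : linear (@psum_out_fun x).
Proof.
move=> a u v; have [r ur ruv] := dsum_supp u v.
rewrite !(@psum_outE x _ r) //.
- by rewrite scaler_sumr -big_split; apply: eq_bigr => i _; exact: linearP.
- by move=> i /ruv[].
- by move=> i /ruv[].
- move=> i /ruv[ui vi].
  by change (a *: dsum_val u i + dsum_val v i = 0); rewrite ui vi scaler0 addr0.
Qed.

HB.instance Definition _ x := GRing.isLinear.Build k (psum F x) (N x) _
  (@psum_out_fun x) (@psum_out_linear x).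

Lemma psum_out_nat x y (h : (x <= y)%O) u :
  psum_out_fun (ptrans (psum F) h u) = ptrans N h (psum_out_fun u).
Proof.
have [r ur ru] := dsum_supp u u.
rewrite !(@psum_outE _ _ r) //.
- by rewrite linear_sum; apply: eq_bigr => i _; exact: pnat.
- by move=> i /ru[].
- move=> i /ru[ui _].
  by change (ptrans (F i) h (dsum_val u i) = 0); rewrite ui linear0.
Qed.

Definition psum_out : pmor (psum F) N :=
  @PMor k d P (psum F) N (fun x => [the {linear _ -> _} of @psum_out_fun x])
    psum_out_nat.

End Out.

Section In.
Variable i : I.

(** The inclusion of the i-th summand. *)
Definition psum_in_val x (v : F i x) : dprod (fun j => F j x) := fun j =>
  if pselect (i = j) is left e then ecast j (F j x) e v else 0.

Lemma psum_in_finsupp x (v : F i x) : psum_in_val v \in @finsupp k I (fun j => F j x).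
Proof.
apply/asboolP; apply: (sub_finite_set (B := [set i])); last exact: finite_set1.
by move=> j; rewrite /dsupp /psum_in_val /=; case: (pselect (i = j)).
Qed.

Definition psum_in_fun x (v : F i x) : psum F x := DSum (psum_in_finsupp v).

Lemma psum_in_linear x : linear (@psum_in_fun x).
Proof.
move=> a u v; apply: val_inj; apply: functional_extensionality_dep => j.
change (psum_in_val (a *: u + v) j = a *: psum_in_val u j + psum_in_val v j).
rewrite /psum_in_val; case: (pselect (i = j)) => [e|_]; last by rewrite scaler0 addr0.
by case: _ / e.
Qed.

HB.instance Definition _ x := GRing.isLinear.Build k (F i x) (psum F x) _
  (@psum_in_fun x) (@psum_in_linear x).

Lemma psum_in_nat x y (h : (x <= y)%O) v :
  psum_in_fun (ptrans (F i) h v) = ptrans (psum F) h (psum_in_fun v).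
Proof.
apply: val_inj; apply: functional_extensionality_dep => j.
change (psum_in_val (ptrans (F i) h v) j = ptrans (F j) h (psum_in_val v j)).
rewrite /psum_in_val; case: (pselect (i = j)) => [e|_]; last by rewrite linear0.
by case: _ / e.
Qed.

Definition psum_in : pmor (F i) (psum F) :=
  @PMor k d P (F i) (psum F) (fun x => [the {linear _ -> _} of @psum_in_fun x])
    psum_in_nat.

Lemma psum_in_same x v : psum_in_val v i = v :> F i x.
Proof.
rewrite /psum_in_val; case: (pselect (i = i)) => // e.
by rewrite (Prop_irrelevance e erefl).
Qed.

Lemma psum_in_other x (v : F i x) j : i <> j -> psum_in_val v j = 0.
Proof. by rewrite /psum_in_val; case: (pselect (i = j)). Qed.

End In.

Lemma psum_out_in (N : pmod k P) (f : forall i, pmor (F i) N) i x (v : F i x) :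
  psum_out f x (psum_in i x v) = f i x v.
Proof.
rewrite [LHS](@psum_outE _ _ _ _ [:: i]) //.
  by rewrite big_seq1 /= psum_in_same.
by move=> j; rewrite inE => /eqP ij /=; apply: psum_in_other => /esym.
Qed.

Lemma dsum_val_sum x (r : seq {classic I}) (G : I -> psum F x) j :
  dsum_val (\sum_(i <- r) G i) j = \sum_(i <- r) dsum_val (G i) j.
Proof. by elim: r => [|i r IH]; rewrite ?big_nil // !big_cons -IH. Qed.

(** Morphisms out of a direct sum are determined by their restrictions to the
    summands, since every element is a finite sum of elements of the summands. *)
Lemma psum_ext (N : pmod k P) (f g : pmor (psum F) N) :
  (forall i, peq (pcomp f (psum_in i)) (pcomp g (psum_in i))) -> peq f g.
Proof.
move=> fg x u; have [r ur ru] := dsum_supp u u.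
have -> : u = \sum_(i <- r) psum_in i x (dsum_val u i).
  apply: val_inj; apply: functional_extensionality_dep => j.
  rewrite [RHS]dsum_val_sum /=.
  have [jr|/[dup] jr /ru[-> _]] := boolP ((j : {classic I}) \in r).
    rewrite (bigD1_seq _ jr) //= psum_in_same big1 ?addr0 // => i /eqP ij.
    exact: psum_in_other.
  rewrite big_seq big1 // => i ir; apply: psum_in_other => ij.
  by rewrite -ij ir in jr.
by rewrite !linear_sum; apply: eq_bigr => i _; apply: fg.
Qed.

End Universal.
End Sums.

Section SumsOfSums.
Variables (k : fieldType) (d : Order.disp_t) (P : porderType d).

Lemma psum_psum (I J : Type) (F : I -> J -> pmod k P) :
  piso (psum (fun i => psum (F i))) (psum (fun ij : I * J => F ij.1 ij.2)).
Proof.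
pose f := psum_out (fun i => psum_out (fun j =>
  psum_in (fun ij : I * J => F ij.1 ij.2) (i, j))).
pose g := psum_out (fun ij : I * J =>
  pcomp (psum_in (fun i => psum (F i)) ij.1) (psum_in (F ij.1) ij.2)).
have fE i j x v : f x (psum_in _ i x (psum_in _ j x v)) = psum_in _ (i, j) x v.
  by rewrite /f !psum_out_in.
have gE i j x v : g x (psum_in _ (i, j) x v) = psum_in _ i x (psum_in _ j x v).
  by rewrite /g psum_out_in.
exists f, g; split.
  apply: psum_ext => i; apply: (psum_ext (f := pcomp _ _) (g := pcomp _ _)).
  by move=> j x v /=; rewrite [f x _]fE [LHS]gE.
by apply: psum_ext => -[i j] x v /=; rewrite [g x _]gE [LHS]fE.
Qed.

(** [free_mod] uses the canonical tuple on a sequence; any tuple of the same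
    elements gives an isomorphic module. *)
Lemma piso_free_mod n (t : n.-tuple P) :
  piso (psum (fun i => imod k (upint (tnth t i)))) (free_mod k t).
Proof.
case: t => s /= e; have ne := eqP e; case: n / ne e => e.
rewrite /free_mod; have -> : in_tuple s = Tuple e by apply: val_inj.
exact: piso_refl.
Qed.

End SumsOfSums.

(** * Thin modules *)

Section Thin.
Variables (k : fieldType) (d : Order.disp_t) (P : porderType d).
Implicit Types (T : set P) (M N : pmod k P).

(** A partial section of N over T, extended by 0 outside T, that transition maps
    starting in T preserve.  Leaving T must therefore kill it. *)
Definition tsection T N (w : forall x, N x) :=
  (forall x, ~ T x -> w x = 0) /\
  (forall x y (h : (x <= y)%O), T x -> ptrans N h (w x) = w y).

(** M is thin with support T, generated by g: it is of dimension 1 on T and 0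
    elsewhere, and the transition maps inside T match the generators.  This
    describes the interval module of T, except that T need not be connected. *)
Definition thin T M (g : forall x, M x) := [/\ tsection T g,
  forall x u, exists a : k, u = a *: g x & forall x, T x -> g x <> 0].

(** Thin modules represent partial sections: a morphism out of one is given by
    the images of the generators. *)
Lemma thin_map T M N g w : @thin T M g -> @tsection T N w ->
  exists f : pmor M N, forall x, f x (g x) = w x.
Proof.
move=> [[g0 gt] gg gn0] [w0 wt].
have wd x a b : a *: g x = b *: g x -> a *: w x = b *: w x.
  have [Tx|/w0 ->] := pselect (T x); last by rewrite !scaler0.
  move=> /eqP; rewrite -subr_eq0 -scalerBl scaler_eq0 => /orP[|/eqP/gn0 //].
  by rewrite subr_eq0 => /eqP ->.
pose c x u := projT1 (cid (gg x u)).
have cK x u : u = c x u *: g x := projT2 (cid (gg x u)).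
have lin x : linear (fun u => c x u *: w x).
  move=> a u v /=; rewrite scalerA -scalerDl; apply: wd.
  by rewrite scalerDl -scalerA -!cK.
pose f x : {linear M x -> N x} := HB.pack (fun u => c x u *: w x)
  (GRing.isLinear.Build k (M x) (N x) _ (fun u => c x u *: w x) (lin x)).
have fg x : f x (g x) = w x.
  by rewrite /f /= -[RHS]scale1r; apply: wd; rewrite -cK scale1r.
clearbody f.
have nat x y (h : (x <= y)%O) u : f y (ptrans M h u) = ptrans N h (f x u).
  have [a ->] := gg x u; rewrite !linearZ fg; congr (a *: _).
  have [Tx|nTx] := pselect (T x); first by rewrite gt // fg wt.
  by rewrite g0 // w0 // !linear0.
by exists (PMor nat) => x; apply: fg.
Qed.

Lemma thin_ext T M N g (f f' : pmor M N) : @thin T M g ->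
  (forall x, T x -> f x (g x) = f' x (g x)) -> peq f f'.
Proof.
move=> [[g0 _] gg _] ff' x u; have [a ->] := gg x u.
have [Tx|/g0 ->] := pselect (T x); last by rewrite scaler0 !linear0.
by rewrite !linearZ ff'.
Qed.

Lemma thin_piso T M N g g' : @thin T M g -> @thin T N g' -> piso M N.
Proof.
move=> gM gN; have [sM _ _] := gM; have [sN _ _] := gN.
have [f fE] := thin_map gM sN; have [f' f'E] := thin_map gN sM.
exists f, f'; split; [apply: (thin_ext gM)|apply: (thin_ext gN)] => x _ /=.
  by rewrite fE f'E.
by rewrite f'E fE.
Qed.

Lemma thin_eq0 T M g x (u : M x) : @thin T M g -> ~ T x -> u = 0.
Proof. by move=> [[g0 _] gg _] /g0 gx0; have [a ->] := gg x u; rewrite gx0 scaler0. Qed.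

Lemma imod_thin (S : interval P) : @thin S (imod k S) (fun x => const_mx 1).
Proof.
split; first split.
- move=> x nSx; rewrite /imod /=.
  have -> : (x \in (S : set P)) = false by exact: memNset.
  by apply/matrixP=> i [].
- move=> x y h Sx; rewrite /imod /=.
  have -> : (x \in (S : set P)) = true by exact: mem_set.
  by apply/matrixP=> i j; rewrite !mxE big_ord1 !mxE mulr1.
- move=> x; rewrite /imod /=; case: (x \in _) => u /=.
    by exists (u 0 0); apply/matrixP=> i j; rewrite !mxE mulr1 !ord1.
  by exists 0; apply/matrixP=> i [].
- move=> x Sx; rewrite /imod /=.
  have -> : (x \in (S : set P)) = true by exact: mem_set.
  by move=> /matrixP /(_ 0 0); rewrite !mxE => /eqP; rewrite oner_eq0.
Qed.

(** A thin module on a convex set is interval-decomposable: it is the direct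
    sum of the interval modules of the connected components. *)
Section Components.
Variable (T : set P).
Hypothesis convT : convex_set T.

(** The points that can be reached from x by a zigzag in T. *)
Definition reach (x : P) : set P := [set y | exists s : seq P,
  [/\ forall z, z \in s -> T z, path >=<%O x s & last x s = y]].

(** The connected component of T with underlying set A; it is empty when A is
    not a component.  Every set is thus allowed as an index, at the price of
    zero summands. *)
Definition component (A : set P) : set P := [set x | T x /\ reach x = A].

Lemma reach_step x y : T x -> T y -> (x >=< y)%O -> reach x = reach y.
Proof.
have step u v : T u -> (u >=< v)%O -> reach u `<=` reach v.
  move=> Tu uv z [s [sT us sz]]; exists (u :: s); split=> //=.
    by move=> t; rewrite inE => /orP[/eqP ->|/sT].
  by rewrite comparable_sym uv.
move=> Tx Ty xy; apply/seteqP; split; apply: step => //.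
by rewrite comparable_sym.
Qed.

Lemma component_convex A : convex_set (component A).
Proof.
move=> x y z [Tx <-] [Ty _] xz zy; have Tz := convT Tx Ty xz zy.
by split=> //; apply: reach_step => //; rewrite /Order.comparable xz orbT.
Qed.

Lemma component_connected A : connected_set (component A).
Proof.
move=> x y [Tx <-] [Ty xy].
have : reach y y by exists [::].
rewrite xy => -[s [sT xs sy]]; exists s; split=> //.
elim: s x Tx sT xs {xy sy} => // u s IH x Tx sT /= /andP[xu us] z.
have Tu : T u by apply: sT; rewrite inE eqxx.
rewrite (reach_step Tx Tu xu) inE => /orP[/eqP -> //|].
by apply: IH => // w ws; apply: sT; rewrite inE ws orbT.
Qed.

Definition comp_int A : interval P :=
  Interval (@component_convex A) (@component_connected A).

Definition components_mod := psum (fun A : set P => imod k (comp_int A)).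

Lemma components_gen_finsupp x :
  (fun A => const_mx 1 : imod k (comp_int A) x)
    \in @finsupp k _ (fun A => imod k (comp_int A) x).
Proof.
apply/asboolP; apply: (sub_finite_set (B := [set reach x])); last exact: finite_set1.
move=> A /= nz; apply: contrapT => xA; apply: nz.
change (const_mx 1 = 0 :> imod k (comp_int A) x).
by apply: (thin_eq0 _ (imod_thin (comp_int A))) => -[_ /esym].
Qed.

(** Only the summand indexed by [reach x] is nonzero at x; in the other summands
    the all-ones row has length 0. *)
Definition components_gen x : components_mod x := DSum (components_gen_finsupp x).

Lemma components_thin : thin T components_gen.
Proof.
have im A := imod_thin (comp_int A).
split; first split.
- move=> x nTx; apply: val_inj; apply: functional_extensionality_dep => A.
  by apply: (thin_eq0 _ (im A)) => -[].
- move=> x y h Tx; apply: val_inj; apply: functional_extensionality_dep => A.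
  have [[i0 it] _ _] := im A.
  change (ptrans (imod k (comp_int A)) h (const_mx 1) = const_mx 1).
  have [Ax|nAx] := pselect (component A x); first exact: it.
  have [Ay|nAy] := pselect (component A y); last first.
    by apply: etrans (esym _); exact: (thin_eq0 _ (im A)).
  case: nAx; case: Ay => Ty <-; split=> //; apply: reach_step => //.
  by rewrite /Order.comparable h.
- move=> x u; have [Tx|nTx] := pselect (T x).
    have [_ /(_ x (dsum_val u (reach x))) [a ua] _] := im (reach x).
    exists a; apply: val_inj; apply: functional_extensionality_dep => A.
    have [<- //|nA] := pselect (reach x = A).
    by apply: etrans (esym _); apply: (thin_eq0 _ (im A)) => -[].
  exists 0; apply: val_inj; apply: functional_extensionality_dep => A.
  by apply: etrans (esym _); apply: (thin_eq0 _ (im A)) => -[].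
- move=> x Tx g0; have [_ _ /(_ x)] := im (reach x); apply=> //.
  by change (dsum_val (components_gen x) (reach x) = 0); rewrite g0.
Qed.

End Components.
End Thin.

(** * The induction functor *)

Section Induced.
Variables (k : fieldType) (d : Order.disp_t) (P : porderType d) (Q : set P).
Hypothesis hQ : interior_system Q.
Let fl := floor hQ.
Implicit Types M N : pmod k (subposet Q).

Lemma floor_val_le (q : subposet Q) : (fl (val q) <= q)%O.
Proof. exact: (floor_le hQ (val q)). Qed.

Lemma floorK (q : subposet Q) : fl (val q) = q.
Proof. by apply/le_anti; rewrite floor_val_le le_floor_val. Qed.

Lemma Ind_pbij M N (f : pmor M N) : pbij f -> pbij (Ind_mor hQ f).
Proof.
by move=> [g [gf fg]]; exists (Ind_mor hQ g); split=> x v; [apply: gf|apply: fg].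
Qed.

Lemma Ind_piso M N : piso M N -> piso (Ind hQ M) (Ind hQ N).
Proof. by move=> [f fb]; exists (Ind_mor hQ f); apply: Ind_pbij. Qed.

Lemma Ind_psurj M N (f : pmor M N) : psurj f -> psurj (Ind_mor hQ f).
Proof. by move=> sf x; apply: sf. Qed.

Lemma Ind_pexact L M N (g : pmor L M) (f : pmor M N) :
  pexact g f -> pexact (Ind_mor hQ g) (Ind_mor hQ f).
Proof. by move=> gf x; apply: gf. Qed.

Lemma Ind_pzero M : pzero (Ind hQ M) <-> pzero M.
Proof.
split=> [M0 q v|M0 x v]; last exact: M0.
rewrite -[v](ptrans_id (lexx q)).
by rewrite (ptrans_comp (le_floor_val hQ q) (floor_val_le q)) [ptrans M _ v]M0 linear0.
Qed.

Lemma Ind_thin T M g : @thin k d _ T M g ->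
  @thin k d _ [set x | T (fl x)] (Ind hQ M) (fun x => g (fl x)).
Proof.
move=> [[g0 gt] gg gn]; split; first split.
- by move=> x; apply: g0.
- by move=> x y h; apply: gt.
- by move=> x; apply: gg.
- by move=> x; apply: gn.
Qed.

Lemma Ind_psum (I : Type) (F : I -> pmod k (subposet Q)) :
  piso (Ind hQ (psum F)) (psum (fun i => Ind hQ (F i))).
Proof.
pose f : pmor (Ind hQ (psum F)) (psum (fun i => Ind hQ (F i))) :=
  @PMor k d P (Ind hQ (psum F)) (psum (fun i => Ind hQ (F i)))
    (fun x => [the {linear psum F (fl x) -> psum F (fl x)} of idfun])
    (fun _ _ _ _ => erefl).
by exists f; apply: pbijP => // x v; exists v.
Qed.

(** Ind sends the interval module of the up-set of q in Q to that of the up-set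
    of q in P, because [q <= floor x] means [q <= x]. *)
Lemma Ind_free_mod (s : seq (subposet Q)) :
  piso (Ind hQ (free_mod k s)) (free_mod k (map val s)).
Proof.
apply: piso_trans (Ind_psum _) _.
apply: piso_trans (piso_free_mod k (map_tuple val (in_tuple s))).
apply: piso_psum => i; apply: thin_piso (Ind_thin (imod_thin k _)) _.
set a := tnth (in_tuple s) i.
have -> : [set x | iset (upint a) (fl x)] = upint (tnth (map_tuple val (in_tuple s)) i).
  rewrite tnth_map -/a; apply/seteqP; split=> x /= ax.
    exact: le_trans (floor_le hQ x).
  exact: floor_max.
exact: imod_thin.
Qed.

Lemma fprep_Ind M : fprep M -> fprep (Ind hQ M).
Proof.
move=> /fprepP[J [I [A [B [f [p [AJ BI sp ex]]]]]]].
apply/fprepP; exists (map val J), (map val I), _, _, (Ind_mor hQ f), (Ind_mor hQ p).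
split.
- exact: piso_trans (Ind_piso AJ) (Ind_free_mod _).
- exact: piso_trans (Ind_piso BI) (Ind_free_mod _).
- exact: Ind_psurj.
- exact: Ind_pexact.
Qed.

Lemma floor_preim_convex (S : interval (subposet Q)) :
  convex_set [set x | iset S (fl x)].
Proof.
move=> x y z Sx Sy xz zy.
by apply: iconvex Sx Sy _ _; apply: floor_mono.
Qed.

(** x is joined to y by going down to [floor x], along a path in Q to [floor y],
    and up to y. *)
Lemma floor_preim_connected (S : interval (subposet Q)) :
  connected_set [set x | iset S (fl x)].
Proof.
have val_in q : iset S q -> [set x | iset S (fl x)] (val q) by rewrite /= floorK.
move=> x y Sx Sy; have [s [sS xs sy]] := iconnected Sx Sy.
have qx : (val (fl x) <= x)%O := floor_le hQ x.
have yr : (val (fl y) <= y)%O := floor_le hQ y.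
have {}Sx : iset S (fl x) := Sx; have xs' : path >=<%O (fl x) s := xs.
have {sy}sy' : last (fl x) s = fl y := sy.
move: (fl x) (fl y) Sx xs' qx yr sy' => q r Sq qs qx ry sr.
exists (val q :: rcons (map val s) y); split.
- move=> z; rewrite inE mem_rcons inE => /orP[/eqP ->|/orP[/eqP -> //|]].
    exact: val_in.
  by move=> /mapP[t /sS St ->]; apply: val_in.
- rewrite /= rcons_path last_map sr; apply/and3P; split.
  + by rewrite /Order.comparable qx orbT.
  + by rewrite path_map.
  + by rewrite /Order.comparable ry.
- by rewrite /= last_rcons.
Qed.

Definition floor_preim (S : interval (subposet Q)) : interval P :=
  Interval (@floor_preim_convex S) (@floor_preim_connected S).

Lemma int_decomposable_Ind M : int_decomposable M -> int_decomposable (Ind hQ M).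
Proof.
move=> [I [S MS]]; exists I, (fun i => floor_preim (S i)).
apply: piso_trans (Ind_piso MS) _; apply: piso_trans (Ind_psum _) _.
apply: piso_psum => i; apply: thin_piso (Ind_thin (imod_thin k (S i))) _.
exact: (imod_thin k (floor_preim (S i))).
Qed.

Lemma fp_int_decomposable_Ind M :
  fp_int_decomposable M -> fp_int_decomposable (Ind hQ M).
Proof. by move=> [fM dM]; split; [apply: fprep_Ind|apply: int_decomposable_Ind]. Qed.

(** Restricting f to Q, where floor is the identity, gives the preimage of f;
    naturality of f along [floor x <= x] shows that f is determined there. *)
Lemma Ind_full M N (f : pmor (Ind hQ M) (Ind hQ N)) :
  exists g : pmor M N, peq (Ind_mor hQ g) f.
Proof.
pose app q : {linear M q -> N q} :=
  [the {linear _ -> _} of ptrans N (floor_val_le q) \o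
    (f (val q) \o ptrans M (le_floor_val hQ q))].
have appE x (v : M (fl x)) : app (fl x) v = f x v.
  rewrite /app /=; set u := ptrans M _ v.
  rewrite (bool_irrelevance (floor_val_le (fl x)) (floor_mono hQ (floor_le hQ x))).
  rewrite -[LHS](pnat f (floor_le hQ x) u); congr (f x _).
  rewrite /u -[RHS](ptrans_id (lexx (fl x))).
  exact/esym/(ptrans_comp (le_floor_val hQ (fl x)) (floor_mono hQ (floor_le hQ x))).
have nat q r (h : (q <= r)%O) v : app r (ptrans M h v) = ptrans N h (app q v).
  have h' : (val q <= val r)%O := h.
  pose hm := floor_mono hQ h'.
  have h1 : (q <= fl (val r))%O := le_trans h (le_floor_val hQ r).
  have h2 : (fl (val q) <= r)%O := le_trans (floor_val_le q) h.
  rewrite /app /= -(ptrans_comp h _ h1) (ptrans_comp (le_floor_val hQ q) hm h1).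
  rewrite [f _ _](pnat f h').
  rewrite -(ptrans_comp (floor_val_le q) h h2).
  exact/esym/(ptrans_comp hm (floor_val_le r) h2).
by exists (PMor nat) => x v; apply: appE.
Qed.

Lemma Ind_faithful M N (f g : pmor M N) :
  peq (Ind_mor hQ f) (Ind_mor hQ g) -> peq f g.
Proof.
move=> fg q v; rewrite -[v](ptrans_id (lexx q)).
rewrite (ptrans_comp (le_floor_val hQ q) (floor_val_le q)) pnat [RHS]pnat.
by congr (ptrans N _ _); exact: (fg (val q)).
Qed.

End Induced.

(** * Universal arrows to the induction functor *)

Section UniversalArrows.
Variables (k : fieldType) (d : Order.disp_t) (P : porderType d) (Q : set P).
Hypothesis hQ : interior_system Q.
Let fl := floor hQ.

(** eta is a universal arrow from U to Ind: every morphism [U -> Ind N] factors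
    through eta by Ind of a unique morphism [L -> N].  Equivalently, L is the
    value at U of the left adjoint of Ind, and eta is the unit. *)
Definition univ (U : pmod k P) (L : pmod k (subposet Q)) (eta : pmor U (Ind hQ L)) :=
  (forall N (g : pmor U (Ind hQ N)), exists h, peq (pcomp (Ind_mor hQ h) eta) g) /\
  (forall N (h h' : pmor L N),
     peq (pcomp (Ind_mor hQ h) eta) (pcomp (Ind_mor hQ h') eta) -> peq h h').

Lemma univ_unique U L L' (eta : pmor U (Ind hQ L)) (eta' : pmor U (Ind hQ L')) :
  univ eta -> univ eta' -> piso L L'.
Proof.
move=> [ex un] [ex' un']; have [h hE] := ex _ eta'; have [h' h'E] := ex' _ eta.
exists h, h'; split; [apply: un|apply: un'] => x v /=.
  by rewrite [h _ _]hE [LHS]h'E.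
by rewrite [h' _ _]h'E [LHS]hE.
Qed.

Lemma univ_pbij U U' L (eta : pmor U (Ind hQ L)) (e : pmor U' U) :
  pbij e -> univ eta -> univ (pcomp eta e).
Proof.
move=> be [ex un]; have [e' [e'e ee']] := be; split=> [N g|N h h' hh'].
  have [h hE] := ex _ (pcomp g e'); exists h => x v.
  by rewrite [LHS]hE /= [e' x _]e'e.
apply: un; apply: psurj_epi (pbij_surj be) _.
by move=> x v; apply: hh'.
Qed.

Lemma univ_psum (I : Type) (U : I -> pmod k P) (L : I -> pmod k (subposet Q))
    (eta : forall i, pmor (U i) (Ind hQ (L i))) : (forall i, univ (eta i)) ->
  exists eta' : pmor (psum U) (Ind hQ (psum L)), univ eta'.
Proof.
move=> uni; exists (psum_out (fun i => pcomp (Ind_mor hQ (psum_in L i)) (eta i))).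
split=> [N g|N h h' hh'].
  pose h i := projT1 (cid ((uni i).1 _ (pcomp g (psum_in U i)))).
  have hE i : peq (pcomp (Ind_mor hQ (h i)) (eta i)) (pcomp g (psum_in U i)).
    exact: projT2 (cid ((uni i).1 _ (pcomp g (psum_in U i)))).
  exists (psum_out h); apply: psum_ext => i x v; rewrite -[RHS]hE /=.
  by rewrite [X in psum_out_fun _ X]psum_out_in [LHS]psum_out_in.
apply: psum_ext => i; apply: (uni i).2 => x v.
by have := hh' x (psum_in U i x v); rewrite /= !psum_out_in.
Qed.

(** A left adjoint preserves cokernels. *)
Lemma univ_coker U1 U0 U L1 L0 (f : pmor U1 U0) (p : pmor U0 U)
    (e1 : pmor U1 (Ind hQ L1)) (e0 : pmor U0 (Ind hQ L0)) :
  psurj p -> pexact f p -> univ e1 -> univ e0 ->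
  exists (f' : pmor L1 L0) (eta : pmor U (Ind hQ (pcoker f'))), univ eta.
Proof.
move=> sp ex [ex1 un1] [ex0 un0].
have [f' f'E] := ex1 _ (pcomp e0 f); exists f'.
have sq := @pcoker_proj_surj _ _ _ _ _ f'.
have exq := @pcoker_proj_exact _ _ _ _ _ f'; set q := pcoker_proj f' in sq exq.
have [eta etaE] : exists eta : pmor U (Ind hQ (pcoker f')),
    peq (pcomp eta p) (pcomp (Ind_mor hQ q) e0).
  refine (psurj_factor sp _) => x v /ex[u <-] /=.
  by apply/exq; exists (e1 x u); apply: f'E.
exists eta; split=> [N g|N h h' hh'].
  have [h0 h0E] := ex0 _ (pcomp g p).
  have h0f' : peq (pcomp h0 f') (pnull L1 N).
    apply: un1 => x v /=; rewrite [f' _ _]f'E [LHS]h0E /=.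
    by apply: etrans (linear0 (g x)); congr (g x _); apply/ex; exists v.
  have [h hE] : exists h : pmor (pcoker f') N, peq (pcomp h q) h0.
    by refine (psurj_factor sq _) => x v /exq[u <-]; apply: h0f'.
  exists h; apply: (psurj_epi sp) => x v /=; rewrite [eta _ _]etaE.
  by rewrite [LHS]hE; apply: h0E.
apply: (psurj_epi sq); apply: un0 => x v /=.
by have := hh' x (p x v); rewrite /= [eta _ _]etaE.
Qed.

End UniversalArrows.

(** * Contraction of interval modules *)

Section Contraction.
Variables (k : fieldType) (d : Order.disp_t) (P : porderType d) (Q : set P).
Hypothesis hQ : interior_system Q.
Hypothesis aQ : aligned hQ.
Let fl := floor hQ.

(** The support of the left adjoint of Ind at the thin module on S: those y for
    which the restriction of S to [{a | floor a <= y}] has a nonempty part that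
    is closed upwards in this set. *)
Definition contraction (S : set P) : set (subposet Q) := [set y | exists a,
  [/\ S a, (fl a <= y)%O & forall c, (a <= c)%O -> (fl c <= y)%O -> S c]].

(** Alignment makes the choice of the witness irrelevant: over a point of the
    contraction, S is closed upwards from each of its points.  An upper bound of
    the witness b and c lies in S, and convexity of S gives c. *)
Lemma contraction_stays (S : set P) y a : convex_set S -> contraction S y ->
  S a -> (fl a <= y)%O -> forall c, (a <= c)%O -> (fl c <= y)%O -> S c.
Proof.
move=> cS [b [Sb by_ bS]] Sa ay c ac cy.
have [e [/= ey be ce]] := aQ by_ cy.
exact: cS Sa (bS e be ey) ac ce.
Qed.

Lemma contraction_convex (S : set P) : convex_set S -> convex_set (contraction S).
Proof.
move=> cS x y z [a [Sa ax aS]] Sy xz zy; have az := le_trans ax xz.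
exists a; split=> // c ac cz.
exact: contraction_stays cS Sy Sa (le_trans az zy) c ac (le_trans cz zy).
Qed.

Lemma contraction_floor (S : set P) y a : convex_set S -> contraction S y ->
  S a -> (fl a <= y)%O -> contraction S (fl a).
Proof.
move=> cS Sy Sa ay; exists a; split=> // c ac ca.
exact: contraction_stays cS Sy Sa ay c ac (le_trans ca ay).
Qed.

Lemma contraction_escape (S : set P) y a : ~ contraction S y -> S a ->
  (fl a <= y)%O -> exists c, [/\ (a <= c)%O, (fl c <= y)%O & ~ S c].
Proof.
move=> nSy Sa ay; apply: contrapT => nc; apply: nSy; exists a; split=> // c ac cy.
by apply: contrapT => nSc; apply: nc; exists c.
Qed.

Lemma contraction_upset a : contraction (upset a) = upset (fl a).
Proof.
apply/seteqP; split=> y /=; last by move=> ay; exists a; split=> //=; exact: lexx.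
by move=> [c [/= ac cy _]]; apply: le_trans cy; apply: floor_mono.
Qed.

(** The left adjoint of Ind sends the thin module on a convex set S to the thin
    module on its contraction. *)
Lemma univ_thin (S : set P) (U : pmod k P) g (L : pmod k (subposet Q)) gL :
  convex_set S -> @thin k d P S U g -> @thin k d _ (contraction S) L gL ->
  exists eta : pmor U (Ind hQ L), univ eta.
Proof.
move=> cS gU gLL; have [[g0 gt] _ _] := gU; have [[gL0 gLt] _ _] := gLL.
pose w x : Ind hQ L x := if pselect (S x) then gL (fl x) else 0.
have wS x : S x -> w x = gL (fl x) by rewrite /w; case: (pselect (S x)).
have wn x : ~ S x -> w x = 0 by rewrite /w; case: (pselect (S x)).
have w_sec : tsection S w.
  split=> // x y h Sx; rewrite wS //.
  have hf := floor_mono hQ h.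
  have E : ptrans L (floor_mono hQ h) (gL (fl x)) = gL (fl y).
    have [Sfx|nSfx] := pselect (contraction S (fl x)); first exact: gLt.
    rewrite gL0 // linear0 gL0 // => Sfy; apply: nSfx.
    exact: contraction_floor cS Sfy Sx hf.
  apply: etrans E _; have [Sy|nSy] := pselect (S y); first by rewrite wS.
  rewrite wn // gL0 // => Sfy; apply: nSy.
  exact: contraction_stays cS Sfy Sx hf y h (lexx _).
have [eta etaE] := thin_map gU w_sec; exists eta; split=> [N f|N h h' hh'].
  (* The morphism f amounts to the elements [fg a].  Their images in N y, for a
     in S with [floor a <= y], all agree when y lies in the contraction, and
     vanish when y does not, because then some c above a with [floor c <= y] is
     outside S. *)
  pose fg a : N (fl a) := f a (g a).
  have fgt a c (ac : (a <= c)%O) : S a -> ptrans N (floor_mono hQ ac) (fg a) = fg c.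
    by move=> Sa; rewrite /fg -(gt _ _ ac Sa); apply: esym (pnat f ac (g a)).
  have fgc a c y (ac : (a <= c)%O) (ay : (fl a <= y)%O) (cy : (fl c <= y)%O) :
      S a -> ptrans N ay (fg a) = ptrans N cy (fg c).
    by move=> Sa; rewrite (ptrans_comp (floor_mono hQ ac) cy) fgt.
  have fg0 a : ~ S a -> fg a = 0 by move=> nSa; rewrite /fg g0 // linear0.
  have fg_escape a y (ay : (fl a <= y)%O) : ~ contraction S y -> S a ->
      ptrans N ay (fg a) = 0.
    move=> nSy Sa; have [c [ac cy /fg0 c0]] := contraction_escape nSy Sa ay.
    by rewrite (fgc _ _ _ ac ay cy Sa) c0 linear0.
  have ex_u y : exists u : N y, (~ contraction S y -> u = 0) /\
      (contraction S y -> forall a (ay : (fl a <= y)%O), S a -> u = ptrans N ay (fg a)).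
    have [[b [Sb by_ bS]]|nSy] := pselect (contraction S y); last by exists 0.
    exists (ptrans N by_ (fg b)); split=> [[]|_ a ay Sa]; first by exists b.
    have [e [/= ey be ae]] := aQ by_ ay.
    by rewrite (fgc _ _ _ be by_ ey) // (fgc _ _ _ ae ay ey).
  pose u y : N y := projT1 (cid (ex_u y)).
  have u0 y : ~ contraction S y -> u y = 0 := (projT2 (cid (ex_u y))).1.
  have uE y : contraction S y -> forall a (ay : (fl a <= y)%O), S a ->
    u y = ptrans N ay (fg a) := (projT2 (cid (ex_u y))).2.
  have u_sec : tsection (contraction S) u.
    split=> // y z yz Sy; have [a [Sa ay _]] := Sy; have az := le_trans ay yz.
    rewrite (uE _ Sy _ ay) // -(ptrans_comp ay yz az).
    have [Sz|nSz] := pselect (contraction S z); first by rewrite (uE _ Sz _ az).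
    by rewrite u0 // fg_escape.
  have [h hE] := thin_map gLL u_sec; exists h.
  apply: (thin_ext gU) => x Sx /=; rewrite etaE wS // [LHS]hE.
  have [Sfx|nSfx] := pselect (contraction S (fl x)).
    by rewrite (uE _ Sfx _ (lexx _)) // ptrans_id.
  by rewrite u0 // -[RHS](@ptrans_id k d _ N _ (lexx (fl x))) [RHS]fg_escape.
apply: (thin_ext gLL) => y Sy; have [a [Sa ay _]] := Sy.
have Sfa := contraction_floor cS Sy Sa ay.
rewrite -(gLt _ _ ay Sfa) !pnat; congr (ptrans N _ _).
by have := hh' a (g a); rewrite /= etaE wS.
Qed.

Lemma univ_free_mod (s : seq P) : exists (L : pmod k (subposet Q))
  (eta : pmor (free_mod k s) (Ind hQ L)), univ eta /\ piso L (free_mod k (map fl s)).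
Proof.
pose L i := imod k (upint (fl (tnth (in_tuple s) i))).
have uni i : exists eta : pmor (imod k (upint (tnth (in_tuple s) i))) (Ind hQ (L i)),
    univ eta.
  apply: univ_thin (imod_thin k _) _; first exact: iconvex.
  by rewrite contraction_upset; apply: (imod_thin k (upint _)).
have [eta univ_eta] := univ_psum (fun i => projT2 (cid (uni i))).
exists (psum L), eta; split=> //.
apply: piso_trans (piso_free_mod k (map_tuple fl (in_tuple s))).
by apply: piso_psum => i; rewrite tnth_map; apply: piso_refl.
Qed.

Lemma univ_fprep U : fprep U -> exists (L : pmod k (subposet Q))
  (eta : pmor U (Ind hQ L)), univ eta /\ fprep L.
Proof.
move=> /fprepP[J [I [A [B [f [p [[a ba] [b bb] sp ex]]]]]]].
have [LA [eA [uA LAf]]] := univ_free_mod J; have [LB [eB [uB LBf]]] := univ_free_mod I.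
have [f' [eta univ_eta]] := univ_coker sp ex (univ_pbij ba uA) (univ_pbij bb uB).
exists (pcoker f'), eta; split=> //; apply/fprepP.
exists (map fl J), (map fl I), LA, LB, f', (pcoker_proj f'); split=> //.
  exact: pcoker_proj_surj.
exact: pcoker_proj_exact.
Qed.

Lemma univ_int_decomposable U : int_decomposable U -> exists (L : pmod k (subposet Q))
  (eta : pmor U (Ind hQ L)), univ eta /\ int_decomposable L.
Proof.
move=> [I [S [e be]]].
pose conv i := contraction_convex (@iconvex _ _ (S i)).
have uni i : exists eta : pmor (imod k (S i)) (Ind hQ (components_mod k (conv i))),
    univ eta.
  apply: univ_thin (imod_thin k _) (components_thin k _); exact: iconvex.
have [eta univ_eta] := univ_psum (fun i => projT2 (cid (uni i))).
exists (psum (fun i => components_mod k (conv i))), (pcomp eta e).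
split; first exact: univ_pbij.
exists (I * set (subposet Q))%type, (fun ij => comp_int (conv ij.1) ij.2).
exact: psum_psum (fun i j => imod k (comp_int (conv i) j)).
Qed.

Lemma univ_fp_int_decomposable U : fp_int_decomposable U ->
  exists (L : pmod k (subposet Q)) (eta : pmor U (Ind hQ L)),
    univ eta /\ fp_int_decomposable L.
Proof.
move=> [/univ_fprep[L [eta [uL fL]]] /univ_int_decomposable[L' [eta' [uL' dL']]]].
exists L, eta; split=> //; split=> //; have [I [S L'S]] := dL'.
by exists I, S; apply: piso_trans L'S; apply: univ_unique uL uL'.
Qed.

(** Ind preserves interval covers. *)
Theorem Ind_int_cover (M V : pmod k (subposet Q)) (phi : pmor V M) :
  int_cover phi -> int_cover (Ind_mor hQ phi).
Proof.
move=> [[fM dV lift] min]; split; first split.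
- exact: fprep_Ind.
- exact: fp_int_decomposable_Ind.
- move=> U dU psi; have [L [eta [[ex un] dL]]] := univ_fp_int_decomposable dU.
  have [psi' psiE] := ex _ psi; have [chi chiE] := lift _ dL psi'.
  exists (pcomp (Ind_mor hQ chi) eta) => x v; rewrite -[RHS]psiE.
  exact: chiE.
- move=> kappa phik; have [kappa' kE] := Ind_full kappa.
  have [|g [kg gk]] := min kappa'.
    by apply: Ind_faithful => x v; rewrite [LHS]phik /= -[kappa x v]kE.
  exists (Ind_mor hQ g); split=> x v /=.
    by rewrite -[kappa x v]kE; apply: kg.
  by rewrite -[LHS]kE; apply: gk.
Qed.

End Contraction.

(** * Uniqueness of interval resolutions *)

Section Resolutions.
Variables (k : fieldType) (d : Order.disp_t) (P : porderType d).
Implicit Types M N V : pmod k P.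

Lemma int_cover_pbij V M N (phi : pmor V M) (psi : pmor V N) (e : pmor M N) :
  pbij e -> peq (pcomp e phi) psi -> int_cover phi -> int_cover psi.
Proof.
move=> be ephi [[fM dV lift] min]; have [e' [e'e ee']] := be; split; first split=> //.
- by apply: fprep_piso fM; exists e.
- move=> U dU f; have [chi chiE] := lift _ dU (pcomp e' f); exists chi => x v /=.
  by rewrite -[LHS]ephi /= [phi x _]chiE [LHS]ee'.
- move=> kappa psik; apply: min => x v /=.
  by rewrite -[LHS]e'e -[RHS]e'e /= [e x _]ephi [e x _]ephi [psi x v]psik.
Qed.

(** The liftings in both directions compose to endomorphisms over M and M',
    which are automorphisms by minimality. *)
Lemma int_cover_unique V V' M M' (phi : pmor V M) (phi' : pmor V' M') (e : pmor M M') :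
  pbij e -> int_cover phi -> int_cover phi' ->
  exists2 a : pmor V V', pbij a & peq (pcomp phi' a) (pcomp e phi).
Proof.
move=> [e' [e'e ee']] [[_ dV lift] min] [[_ dV' lift'] min'].
have [a aE] := lift' _ dV (pcomp e phi); have [b bE] := lift _ dV' (pcomp e' phi').
exists a => //.
have ba : pauto (pcomp b a).
  by apply: min => x v /=; rewrite [RHS]bE /= [phi' x _]aE [RHS]e'e.
have ab : pauto (pcomp a b).
  by apply: min' => x v /=; rewrite [RHS]aE /= [phi x _]bE [RHS]ee'.
apply: pbijP => x v.
  by have [u <-] := pbij_surj ab v; exists (b x u).
move=> av; apply: (pbij_inj ba); rewrite /= av; exact: linear0.
Qed.

Section KernelMap.
Variables (M N M' N' : pmod k P) (f : pmor M N) (f' : pmor M' N').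
Variables (a : pmor M M') (e : pmor N N').
Hypothesis sq : peq (pcomp f' a) (pcomp e f).

Lemma pker_map_square x v : e x (f x v) = f' x (a x v).
Proof. exact/esym/sq. Qed.

Lemma pker_map_nat x y (h : (x <= y)%O) (v : pker f x) :
  kernel_map (@pker_map_square y) (ptrans (pker f) h v)
  = ptrans (pker f') h (kernel_map (@pker_map_square x) v).
Proof. by apply: val_inj; exact: (pnat a h (val v)). Qed.

(** The morphism of kernels induced by a commutative square. *)
Definition pker_map : pmor (pker f) (pker f') :=
  @PMor k d P (pker f) (pker f')
    (fun x => [the {linear _ -> _} of kernel_map (@pker_map_square x)])
    pker_map_nat.

Lemma pker_map_pbij : pbij a -> pbij e -> pbij pker_map.
Proof.
move=> ba be; apply: pbijP => x v.
  have [u uv] := pbij_surj ba (val v).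
  have fu : u \in kernel_pred (f x).
    apply/eqP; apply: (pbij_inj be); rewrite -[LHS]sq /= uv.
    exact/eqP/(valP v).
  by exists (LKernel fu); apply: val_inj.
move=> bv; apply: val_inj; apply: (pbij_inj ba).
by have := congr1 val bv.
Qed.

End KernelMap.

(** Along the induction, the isomorphism between the i-th terms is compatible
    with the differentials, hence induces an isomorphism of their kernels, of
    which the next terms are covers. *)
Lemma int_resolution_unique M M' (V : aug_seq M) (V' : aug_seq M') :
  piso M M' -> int_resolution V -> int_resolution V' -> forall i, piso (V i) (V' i).
Proof.
move=> [e be] [_ _ exV covV kerV] [_ _ exV' covV' kerV'] i.
suff [e_ [a [_ ba _]]] : exists (e_ : pmor (aug_target M V i) (aug_target M' V' i))
    (a : pmor (V i) (V' i)), [/\ pbij e_, pbij a &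
      peq (pcomp (aug_map V' i) a) (pcomp e_ (aug_map V i))] by exists a.
elim: i => [|i [e_ [a [be_ ba sq]]]].
  by have [a ba aE] := int_cover_unique be covV covV'; exists e, a.
have h x u : aug_map V i x (aug_map V i.+1 x u) = 0 by apply/exV; exists u.
have h' x u : aug_map V' i x (aug_map V' i.+1 x u) = 0 by apply/exV'; exists u.
have [b bb bE] := int_cover_unique (pker_map_pbij sq ba be_) (kerV i h) (kerV' i h').
by exists a, b; split=> // x v; have := congr1 val (bE x v).
Qed.

Lemma resolution_length_eq M (Q : porderType d) (M' : pmod k Q)
    (V : aug_seq M) (V' : aug_seq M') :
  (forall i, pzero (V i) <-> pzero (V' i)) ->
  resolution_length V = resolution_length V'.
Proof.
move=> VV'; rewrite /resolution_length.
by have -> : [set m | ~ pzero (V m)] = [set m | ~ pzero (V' m)]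
  by apply/seteqP; split=> m /=; rewrite VV'.
Qed.

Lemma pzero_piso M N : piso M N -> pzero M -> pzero N.
Proof.
by move=> [f bf] M0 x w; have [v <-] := pbij_surj bf w; rewrite [v]M0 linear0.
Qed.

(** The dimension does not depend on the resolution that computes it. *)
Lemma int_res_dimE M (V : aug_seq M) :
  int_resolution V -> int_res_dim M = resolution_length V.
Proof.
move=> rV; rewrite /int_res_dim; case: pselect => [h|[]]; last by exists V.
apply: resolution_length_eq => i.
have WV := int_resolution_unique (piso_refl M) (projT2 (cid h)) rV i.
by split; apply: pzero_piso => //; apply: piso_sym.
Qed.

(** The augmented sequence over N obtained by composing the last arrow of V with
    [e : M -> N]. *)
Definition aug_comp M N (e : pmor M N) (V : aug_seq M) : aug_seq N :=
  @AugSeq k d P N V (fun i =>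
    match i return pmor (V i) (aug_target N V i) with
    | 0 => pcomp e (aug_map V 0)
    | j.+1 => aug_map V j.+1
    end).

Lemma int_resolution_pbij M N (e : pmor M N) (V : aug_seq M) :
  pbij e -> int_resolution V -> int_resolution (aug_comp e V).
Proof.
move=> be [[fM dV] sV exV covV kerV]; split.
- by split=> //; apply: fprep_piso fM; exists e.
- exact: psurj_comp (pbij_surj be) sV.
- case=> [|i]; last exact: exV.
  move=> x v; rewrite -[X in _ <-> X](exV 0 x v) /=.
  by split=> [/(pbij_inj be)|->]; last exact: linear0.
- exact: int_cover_pbij be _ covV.
- case=> [|i] h; last exact: kerV.
  have h0 x u : aug_map V 0 x (aug_map V 1 x u) = 0 by apply/exV; exists u.
  have sq : peq (pcomp (pcomp e (aug_map V 0)) (pid (V 0))) (pcomp e (aug_map V 0)) by [].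
  apply: (int_cover_pbij (pker_map_pbij sq (pbij_id _) be) _ (kerV 0 h0)).
  by move=> x u; apply: val_inj.
Qed.

Lemma admits_int_resolution_piso M N :
  piso M N -> admits_int_resolution M -> admits_int_resolution N.
Proof. by move=> [e be] [V rV]; exists (aug_comp e V); apply: int_resolution_pbij. Qed.

Lemma int_res_dim_piso M N :
  piso M N -> admits_int_resolution M -> int_res_dim M = int_res_dim N.
Proof.
move=> [e be] [V rV]; rewrite (int_res_dimE rV).
by rewrite (int_res_dimE (int_resolution_pbij be rV)); apply: resolution_length_eq.
Qed.

End Resolutions.

(** * Induced interval resolutions *)

Section InducedResolutions.
Variables (k : fieldType) (d : Order.disp_t) (P : porderType d) (Q : set P).
Hypothesis hQ : interior_system Q.
Hypothesis aQ : aligned hQ.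
Let fl := floor hQ.

Lemma Ind_pker_nat (M N : pmod k (subposet Q)) (f : pmor M N) x y (h : (x <= y)%O) v :
  idfun (ptrans (Ind hQ (pker f)) h v) = ptrans (pker (Ind_mor hQ f)) h v.
Proof. exact: val_inj. Qed.

(** Ind commutes with kernels; at each point the two sides are the same space. *)
Definition Ind_pker (M N : pmod k (subposet Q)) (f : pmor M N) :
    pmor (Ind hQ (pker f)) (pker (Ind_mor hQ f)) :=
  @PMor k d P (Ind hQ (pker f)) (pker (Ind_mor hQ f))
    (fun x => [the {linear lkernel (f (fl x)) -> lkernel (f (fl x))} of idfun])
    (@Ind_pker_nat M N f).

Lemma Ind_pker_pbij M N (f : pmor M N) : pbij (Ind_pker f).
Proof. by apply: pbijP => // x v; exists v. Qed.

(** Ind preserves interval resolutions. *)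
Theorem Ind_int_resolution (M : pmod k (subposet Q)) (V : aug_seq M) :
  int_resolution V -> int_resolution (Ind_seq hQ V).
Proof.
move=> [[fM dV] sV exV covV kerV]; split.
- split; first exact: fprep_Ind.
  by move=> i; apply: fp_int_decomposable_Ind.
- exact: Ind_psurj.
- by case=> [|i]; apply: Ind_pexact; apply: exV.
- exact: Ind_int_cover.
- case=> [|i] h.
    have h0 x u : aug_map V 0 x (aug_map V 1 x u) = 0 by apply/exV; exists u.
    have cov := Ind_int_cover aQ (kerV 0 h0).
    apply: (int_cover_pbij (Ind_pker_pbij (aug_map V 0)) _ cov).
    by move=> x u; apply: val_inj.
  have hi x u : aug_map V i.+1 x (aug_map V i.+2 x u) = 0 by apply/exV; exists u.
  have cov := Ind_int_cover aQ (kerV i.+1 hi).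
  apply: (int_cover_pbij (Ind_pker_pbij (aug_map V i.+1)) _ cov).
  by move=> x u; apply: val_inj.
Qed.

Lemma int_res_dim_Ind (M : pmod k (subposet Q)) :
  admits_int_resolution M -> int_res_dim M = int_res_dim (Ind hQ M).
Proof.
move=> [V rV]; rewrite (int_res_dimE rV) (int_res_dimE (Ind_int_resolution rV)).
by apply: resolution_length_eq => i; apply: iff_sym; apply: Ind_pzero.
Qed.

End InducedResolutions.

Theorem theorem4p10 (k : fieldType) (d : Order.disp_t) (P : porderType d)
    (Q : set P) (hQ : interior_system Q) (aQ : aligned hQ) :
  (forall (M V : pmod k (subposet Q)) (phi : pmor V M),
     fprep M -> int_cover phi -> int_cover (Ind_mor hQ phi))
  /\
  ((forall (M : pmod k (subposet Q)) (V : aug_seq M),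
      fprep M -> int_resolution V -> int_resolution (Ind_seq hQ V))
   /\
   (forall M : pmod k (subposet Q),
      fprep M -> admits_int_resolution M ->
      int_res_dim M = int_res_dim (Ind hQ M)))
  /\
  ((forall M : pmod k (subposet Q), fprep M -> admits_int_resolution M) ->
   (forall X : pmod k P, Ind_image hQ X -> admits_int_resolution X)
   /\
   int_res_gldim k (subposet Q) = sup_int_res_dim (@Ind_image k d P Q hQ)).
Proof.
split; first by move=> M V phi _; apply: Ind_int_cover.
split.
  split; first by move=> M V _; apply: Ind_int_resolution.
  by move=> M _; apply: int_res_dim_Ind.
move=> resQ; have resI (X : pmod k P) : Ind_image hQ X -> admits_int_resolution X.
  move=> [_ [M [fM XM]]]; apply: admits_int_resolution_piso (piso_sym XM) _.
  by have [V rV] := resQ M fM; exists (Ind_seq hQ V); apply: Ind_int_resolution.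
split=> //; rewrite /int_res_gldim /sup_int_res_dim; congr enat_sup.
apply/seteqP; split=> n [].
  move=> M fM <-; exists (Ind hQ M); last exact/esym/int_res_dim_Ind/resQ.
  by split; [apply: fprep_Ind|exists M; split=> //; apply: piso_refl].
move=> X IX <-; have [_ [M [fM XM]]] := IX; exists M => //.
by rewrite (int_res_dim_piso XM (resI X IX)); apply/int_res_dim_Ind/resQ.
Qed.
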